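(* There is no Pythagorean formally real field $F$ whose W-group $\mathcal G_F$ is the group (in the category $\mathcal C$) generated by five involutions $\sigma_1,\dots,\sigma_5$ subject to the relations $\sigma_i^2=1$ ($i=1,\dots,5$) and $(\sigma_1\sigma_2\sigma_3\sigma_4\sigma_5)^2=1$, with $\sigma_1,\dots,\sigma_5$ independent modulo $\Phi_F$.
   Context: All fields have characteristic $0$; Pythagorean: every sum of two squares is a square; formally real: $-1$ is not a sum of squares. $F^{(2)}=F(\sqrt a:a\in\dot F)$; $F^{(3)}$ is the compositum of all quadratic extensions $K$ of $F^{(2)}$ such that $K/F$ is Galois; the W-group is $\mathcal G_F=\mathrm{Gal}(F^{(3)}/F)$ and $\Phi_F$ is its Frattini subgroup. Elements are independent modulo $\Phi_F$ if their images in the $\mathbb F_2$-vector space $\mathcal G_F/\Phi_F$ are linearly independent. $\mathcal C$ is the category of pro-2-groups $G$ such that $g^4=1$ and $g^2$ is central for all $g\in G$. *)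

(* Defs.v *)
From HB Require Import structures.
From mathcomp Require Import all_boot all_order all_algebra all_fingroup all_solvable all_field.
Set Implicit Arguments. Unset Strict Implicit. Unset Printing Implicit Defensive.
Import GRing.Theory.

Definition formally_real (F : fieldType) : Prop :=
  forall s : seq F, (\sum_(x <- s) x ^+ 2)%R <> (- 1)%R.

Definition pythagorean (F : fieldType) : Prop :=
  forall a b : F, exists c : F, (a ^+ 2 + b ^+ 2)%R = (c ^+ 2)%R.

Definition has_all_sqrts (F : fieldType) (L : fieldExtType F) : Prop :=
  forall a : F, exists x : L, (x ^+ 2)%R = (a%:A)%R.

Definition is_F2 (F : fieldType) (L : fieldExtType F) (E2 : {subfield L}) : Prop :=
  (forall (a : F) (x : L), a != 0%R -> (x ^+ 2)%R = (a%:A)%R -> x \in E2)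
  /\ (forall E : {subfield L},
        (forall (a : F) (x : L), a != 0%R -> (x ^+ 2)%R = (a%:A)%R -> x \in E) ->
        (E2 <= E)%VS).

Definition quad_gal_over (F : fieldType) (L : splittingFieldType F)
  (E2 K : {subfield L}) : Prop :=
  [/\ (E2 <= K)%VS, \dim_E2 K = 2%N & galois 1%VS K].

Definition is_F3 (F : fieldType) (L : splittingFieldType F)
  (E2 E3 : {subfield L}) : Prop :=
  (forall K : {subfield L}, quad_gal_over E2 K -> (K <= E3)%VS)
  /\ (forall E : {subfield L},
        (forall K : {subfield L}, quad_gal_over E2 K -> (K <= E)%VS) ->
        (E3 <= E)%VS).

(* Every quadratic extension E2(sqrt b) of E2 which is Galois over F already
   lives in L.  Since L has no ambient algebraic closure, "E2(sqrt b)/F is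
   Galois" is expressed by the standard Kummer criterion:
   sigma(b)/b is a square in E2 for every sigma in Gal(E2/F). *)
Definition contains_all_quad_gal (F : fieldType) (L : splittingFieldType F)
  (E2 : {subfield L}) : Prop :=
  forall b : L, b \in E2 -> b != 0%R ->
    (forall sigma, sigma \in 'Gal(E2 / 1%VS)%g ->
       exists2 c : L, c \in E2 & sigma b = (b * c ^+ 2)%R) ->
    exists y : L, (y ^+ 2)%R = b.

Definition in_C (gT : finGroupType) : Prop :=
  forall g : gT, (g ^+ 4 = 1)%g /\ (g ^+ 2 \in 'Z([set: gT]))%g.

Definition rels5 (gT : finGroupType) (s : 'I_5 -> gT) : Prop :=
  (forall i, (s i ^+ 2 = 1)%g) /\ (((\prod_(i < 5) s i) ^+ 2)%g = 1%g).

(* gT, with generators s, is the group in C presented by five generators and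
   the relations rels5: it lies in C, is generated by s, satisfies rels5, and
   has the universal property with respect to groups in C (finite groups
   suffice, as the objects of C are pro-2 groups). *)
Definition C_presented5 (gT : finGroupType) (s : 'I_5 -> gT) : Prop :=
  [/\ in_C gT,
      (<<[set s i | i : 'I_5]>> = [set: gT])%g,
      rels5 s &
      forall (hT : finGroupType) (h : 'I_5 -> hT), in_C hT -> rels5 h ->
        exists f : gT -> hT, {morph f : x y / (x * y)%g} /\ forall i, f (s i) = h i].

(* x_1..x_5 are independent modulo the Frattini subgroup of G, i.e. their
   images in the F_2-vector space G/Phi(G) are linearly independent:
   no nonempty sub-product lies in Phi(G). *)
Definition indep_mod_Phi (hT : finGroupType) (G : {group hT}) (x : 'I_5 -> hT) : Prop :=
  forall S : {set 'I_5}, S != set0 -> (\prod_(i in S) x i \notin 'Phi(G))%g.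

(* Main.v *)
(* Write nu_x(g) for the sign in g(sqrt x) = +- sqrt x.

   If u + v = 1 and g is an involution of G_F, then g does not negate both sqrt u
   and sqrt v: y = sqrt(1 + sqrt u) lies in F^(3), and if g negates sqrt u then
   y g(y) = +- sqrt v is fixed by g. Hence the nonzero x with nu_x(g) = 1 are
   closed under addition, and so are those with nu_x(g) = -1.

   Conversely, let U, V be disjoint even subsets of {1,...,5}. The presentation
   provides a homomorphism from G_F to the dihedral group of order 8 whose two
   sign characters are negative on the s_i with i in U, resp. i in V. The
   corresponding dihedral extension yields p + q = 1 in F such that sqrt p,
   sqrt q have these characters.

   Apply this to get p + q = 1 with p negative at {1,4}, q at {3,5}, and y + b = 1
   with y negative at {2,4}, b at {1,3}. Then x = yp + b = 1 - yq: by the first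
   expression x is negative at 1 and positive at 4, 5 and at the involution
   s_1...s_5, by the second it is positive at 2 and 3. So x is negative at exactly
   one of s_1,...,s_5 but positive at their product, a contradiction. *)
Require Import Defs.
From HB Require Import structures.
From mathcomp Require Import all_boot all_order all_algebra all_fingroup all_solvable all_field.
From mathcomp Require Import ring.
Set Implicit Arguments. Unset Strict Implicit. Unset Printing Implicit Defensive.
Import GRing.Theory.
Local Open Scope ring_scope.

(** * Stability of F^(2) and F^(3) under automorphisms *)

Lemma galois_of_stable (F : fieldType) (L : splittingFieldType F) (E : {subfield L}) :
  [pchar F] =i pred0 -> (forall g : 'AEnd(L), (g @: E <= E)%VS) -> galois 1%VS E.
Proof.
move=> charF stabE; apply/and3P; split; first exact: sub1v.
  apply/separableP => x _; apply: pcharf0_separable => p.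
  by rewrite -charF; apply: (pchar_lalg L).
by apply/forall_inP => g _; rewrite eqEdim stabE limg_dim_eq ?(eqP (AHom_lker0 g)) ?capv0 /=.
Qed.

(** The image of E under g again satisfies P, so minimality puts E inside it; equality of dimensions
    then makes the two equal. *)
Lemma least_subfield_stable (F : fieldType) (L : splittingFieldType F)
    (P : {subfield L} -> Prop) (E : {subfield L}) :
  P E -> (forall E' : {subfield L}, P E' -> (E <= E')%VS) ->
  (forall (g : 'AEnd(L)) (E' : {subfield L}), P E' -> P (g @: E')%AS) ->
  forall g : 'AEnd(L), (g @: E <= E)%VS.
Proof.
move=> PE minE stabP g; have /minE := stabP g E PE => sEgE.
have/eqP <- : E == (g @: E)%AS :> {vspace L}.
  by rewrite eqEdim sEgE limg_dim_eq ?(eqP (AHom_lker0 g)) ?capv0 /=.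
by [].
Qed.

Lemma F2_stable (F : fieldType) (L : splittingFieldType F) (E2 : {subfield L}) :
  is_F2 E2 -> forall g : 'AEnd(L), (g @: E2 <= E2)%VS.
Proof.
case=> sqE2 minE2.
apply: (@least_subfield_stable _ _ (fun E : {subfield L} => forall (a : F) (x : L),
  a != 0 -> x ^+ 2 = a%:A -> x \in E)) => //.
move=> g E' sqE' a x nz_a x2.
have gK y : g ((g^-1)%AF y) = y.
  by rewrite -comp_lfunE lker0_compfV ?id_lfunE ?AHom_lker0.
rewrite -(gK x) memv_img // (sqE' a) //.
by rewrite -rmorphXn x2 /= linearZ /= rmorph1.
Qed.

Lemma F3_stable (F : fieldType) (L : splittingFieldType F) (E2 E3 : {subfield L}) :
  is_F3 E2 E3 -> forall g : 'AEnd(L), (g @: E3 <= E3)%VS.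
Proof.
case=> quadE3 minE3.
apply: (@least_subfield_stable _ _ (fun E : {subfield L} => forall K : {subfield L},
  quad_gal_over E2 K -> (K <= E)%VS)) => //.
move=> g E' quadE' K qK; have [_ _ /and3P[_ _ /forall_inP nK]] := qK.
have := nK g; rewrite inE kAutfE k1AHom => /(_ isT)/eqP <-.
by rewrite limgS ?quadE'.
Qed.

(** Every K in the compositum contains [E2]. If [E3] does not, there is no such K, and minimality
    collapses [E3] to F. *)
Lemma F2_sub_F3 (F : fieldType) (L : splittingFieldType F) (E2 E3 : {subfield L}) :
  is_F3 E2 E3 -> E3 != 1%VS :> {vspace L} -> (E2 <= E3)%VS.
Proof.
case=> quadE3 minE3; apply: contraR => nE23.
rewrite eqEsubv sub1v andbT; apply: (minE3 1%AS) => K qK; case/negP: nE23.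
by apply: subv_trans (quadE3 K qK); case: qK.
Qed.

(** * Signs of automorphisms on square roots *)

Lemma sqr_sign_sqrt (R : comNzRingType) (b : bool) (z : R) : ((-1) ^+ b * z) ^+ 2 = z ^+ 2.
Proof. by rewrite exprMn sqrr_sign mul1r. Qed.

Section SquareRootSigns.

Variables (F : fieldType) (L : splittingFieldType F) (E : {subfield L}).
Variable sq : F -> L.
Hypothesis char2F : 2%:R != 0 :> F.
Hypothesis sqE : forall x, sq x ^+ 2 = x%:A.

Definition negates (g : gal_of E) (x : F) := g (sq x) != sq x.

Lemma char2L : 2%:R != 0 :> L.
Proof. by rewrite -(rmorph_nat (in_alg L)) fmorph_eq0. Qed.

Lemma gal_alg (g : gal_of E) (x : F) : g x%:A = x%:A.
Proof. by rewrite linearZ /= rmorph1. Qed.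

Lemma sqrt_neq0 (x : F) (z : L) : x != 0 -> z ^+ 2 = x%:A -> z != 0.
Proof.
move=> nz_x z2; apply: contraNneq nz_x => z0; move: z2.
rewrite z0 expr0n /= => /esym/eqP; rewrite scaler_eq0 oner_eq0 orbF.
by [].
Qed.

Lemma sqr_eq_sign (z1 z2 : L) : z1 ^+ 2 = z2 ^+ 2 -> exists b : bool, z1 = (-1) ^+ b * z2.
Proof.
move/eqP; rewrite eqf_sqr => /orP[]/eqP->; first by exists false; rewrite mul1r.
by exists true; rewrite mulN1r.
Qed.

Lemma sign_inj (z : L) (b c : bool) : z != 0 -> (-1) ^+ b * z = (-1) ^+ c * z -> b = c.
Proof.
move=> nz_z /(mulIf nz_z).
have nz : (1 : L) != -1 by rewrite -subr_eq0 opprK char2L.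
by case: b c => [] [] // eq1; case/eqP: nz; [apply: esym eq1 | apply: eq1].
Qed.

Lemma gal_sqrt (g : gal_of E) (x : F) : g (sq x) = (-1) ^+ negates g x * sq x.
Proof.
rewrite /negates; case: eqP => [->|neq] /=; first by rewrite mul1r.
have [b gx] : exists b : bool, g (sq x) = (-1) ^+ b * sq x.
  by apply: sqr_eq_sign; rewrite -rmorphXn /= !sqE gal_alg.
by case: b gx neq => // ->; rewrite mul1r.
Qed.

(** Two square roots of x differ by a sign, which g fixes; hence the sign of g at x can be read off
    from any root, not only from [sq x]. *)
Lemma negates_eq (g : gal_of E) (x : F) (z : L) (b : bool) :
  x != 0 -> z ^+ 2 = x%:A -> g z = (-1) ^+ b * z -> negates g x = b.
Proof.
move=> nz_x z2 gz; have nz_z := sqrt_neq0 nz_x z2.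
have [c Dz] : exists c : bool, z = (-1) ^+ c * sq x by apply: sqr_eq_sign; rewrite z2 sqE.
by apply: (sign_inj nz_z); rewrite -gz Dz rmorphM rmorph_sign /= gal_sqrt mulrCA.
Qed.

Lemma negates1 (g : gal_of E) : negates g 1 = false.
Proof.
by apply: (@negates_eq _ _ 1); rewrite ?oner_eq0 ?expr1n ?scale1r ?mul1r ?rmorph1.
Qed.

Lemma negatesM (g : gal_of E) (x y : F) : x != 0 -> y != 0 ->
  negates g (x * y) = negates g x (+) negates g y.
Proof.
move=> nz_x nz_y; apply: (@negates_eq _ _ (sq x * sq y)); first by rewrite mulf_neq0.
  by rewrite exprMn !sqE mulr_algl scalerA.
by rewrite rmorphM /= !gal_sqrt signr_addb mulrACA.
Qed.

Lemma negates_mulsqr (g : gal_of E) (x y : F) : x != 0 -> y != 0 ->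
  negates g (x * y ^+ 2) = negates g x.
Proof.
by move=> nz_x nz_y; rewrite expr2 !negatesM ?mulf_neq0 // addbb addbF.
Qed.

Lemma negates_sqr (g : gal_of E) (x : F) : x != 0 -> negates g (x ^+ 2) = false.
Proof. by move=> nz_x; rewrite expr2 negatesM ?addbb. Qed.

Hypothesis sq_in : forall x, x != 0 -> sq x \in E.

Lemma negates_mulg (g h : gal_of E) (x : F) : x != 0 ->
  negates (g * h)%g x = negates g x (+) negates h x.
Proof.
move=> nz_x; apply: (@negates_eq _ _ (sq x)) => //.
by rewrite galM ?sq_in // gal_sqrt rmorphM rmorph_sign /= gal_sqrt signr_addb mulrA.
Qed.

Hypothesis galE : galois 1%VS E.

Lemma fixed_in_base (z : L) : z \in E ->
  (forall g, g \in 'Gal(E / 1%VS)%g -> g z = z) -> exists x : F, z = x%:A.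
Proof.
move=> Ez fixz; apply/vlineP.
have <- : fixedField 'Gal(E / 1%VS)%g = 1%VS by apply/galois_fixedField.
exact/fixedFieldP.
Qed.

(** By Dedekind's independence of automorphisms, some sum of chi(y) y(a) over y in H is nonzero;
    translating the summation index by h shows that it is an eigenvector. *)
Lemma eigenvector (H : {group gal_of E}) (chi : gal_of E -> bool) :
  {in H &, {morph chi : g h / (g * h)%g >-> g (+) h}} ->
  exists2 w : L, w \in E & w != 0 /\ {in H, forall h : gal_of E, h w = (-1) ^+ chi h * w}.
Proof.
move=> chiM.
have [|a Ea] := @gal_independent_contra _ L E (mem H) (fun g => (-1) ^+ chi g) _ (group1 H).
  by rewrite signr_eq0.
set w := \sum_(y | _) _ => nz_w; exists w.
  by rewrite rpred_sum // => y _; rewrite rpredMsign memv_gal.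
split=> // h Hh; rewrite /w rmorph_sum /= [in RHS](reindex_inj (mulIg h)) /=.
rewrite mulr_sumr; apply: eq_big => [y | y Hy]; first exact/esym/groupMr.
rewrite rmorphM rmorph_sign /= chiM // galM // signr_addb.
by rewrite -mulrA mulrCA signrMK.
Qed.

End SquareRootSigns.

(** * From dihedral characters to solutions of p + q = 1 *)

Section Dihedral.

Variables (F : fieldType) (L : splittingFieldType F) (E : {subfield L}).
Variable sq : F -> L.
Hypothesis char2F : 2%:R != 0 :> F.
Hypothesis sqE : forall x, sq x ^+ 2 = x%:A.
Hypothesis galE : galois 1%VS E.

Local Notation negates := (negates sq).
Local Notation G := 'Gal(E / 1%VS)%g.

Lemma eigenvector_sqr (chi : gal_of E -> bool) (z : L) :
  z \in E -> z != 0 -> {in G, forall g : gal_of E, g z = (-1) ^+ chi g * z} ->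
  exists x : F, [/\ x != 0, z ^+ 2 = x%:A & {in G, forall g, negates g x = chi g}].
Proof.
move=> Ez nz_z gz.
have [|g Gg|x z2] := @fixed_in_base _ _ _ galE (z ^+ 2); first exact: rpredX.
  by rewrite rmorphXn /= gz // sqr_sign_sqrt.
have nz_x : x != 0.
  by apply: contraNneq nz_z => x0; rewrite -sqrf_eq0 z2 x0 scale0r.
exists x; split=> // g Gg.
exact: (negates_eq char2F sqE nz_x z2 (gz g Gg)).
Qed.

(* On ker al, ga is a character; let w span an eigenline for it. Then w^2 lies in
   F(sqrt u) = F(w0), its conjugate is (t w)^2, and w * t w spans the
   be-eigenline, so that v = (w * t w)^2 is the norm of w^2 = r + s sqrt u. *)
Lemma dihedral_norm (al be ga : gal_of E -> bool) (t : gal_of E) :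
  {in G &, {morph al : g h / (g * h)%g >-> g (+) h}} ->
  {in G &, {morph be : g h / (g * h)%g >-> g (+) h}} ->
  {in G &, forall g h, ga (g * h)%g = ga g (+) ga h (+) (al g && be h)} ->
  t \in G -> al t ->
  exists u v r s : F, [/\ u != 0, v != 0, r ^+ 2 = u * s ^+ 2 + v,
    {in G, forall g, negates g u = al g} & {in G, forall g, negates g v = be g}].
Proof.
move=> alM beM gaM Gt al_t.
have [w0 Ew0 [nz_w0 w0P]] := @eigenvector _ _ _ 'Gal(E / 1%VS)%G al alM.
have [u [nz_u w0sq uP]] := eigenvector_sqr Ew0 nz_w0 w0P.
have al1 : al 1%g = false.
  by have := alM 1%g 1%g (group1 _) (group1 _); rewrite mulg1; case: (al _).
have Hgrp : group_set [set g in G | ~~ al g].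
  apply/group_setP; split=> [|g h]; first by rewrite inE group1 al1.
  rewrite !inE => /andP[Gg al_g] /andP[Gh al_h].
  by rewrite groupM // alM // (negPf al_g) (negPf al_h).
pose H := Group Hgrp.
have HP g : (g \in H) = (g \in G) && ~~ al g by rewrite inE.
have sHG : {in H, forall g, g \in G} by move=> g; rewrite HP => /andP[].
have alH : {in H, forall g, al g = false} by move=> g; rewrite HP => /andP[_ /negPf].
have [|w Ew [nz_w wP]] := @eigenvector _ _ _ H ga.
  by move=> g h Hg Hh /=; rewrite gaM ?sHG // alH // addbF.
have tH (g : gal_of E) : g \in G -> al g -> (g * t^-1)%g \in H.
  move=> Gg al_g; rewrite HP groupM ?groupV // -(addbK (al t) (al _)) -alM ?groupM ?groupV //.
  by rewrite mulgKV al_g al_t.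
(* G is the union of H and its coset H t, so an eigenvector for H and for t is one for G. *)
have swap (chi : gal_of E -> bool) (z : L) : z \in E ->
    {in G &, {morph chi : g h / (g * h)%g >-> g (+) h}} ->
    {in H, forall h : gal_of E, h z = (-1) ^+ chi h * z} -> t z = (-1) ^+ chi t * z ->
    {in G, forall g : gal_of E, g z = (-1) ^+ chi g * z}.
  move=> Ez chiM Hz tz g Gg; case al_g: (al g); last by apply: Hz; rewrite HP Gg al_g.
  have Hk := tH _ Gg al_g.
  rewrite -{1}(mulgKV t g) galM // Hz // rmorphM rmorph_sign /= tz mulrA -signr_addb.
  by rewrite -chiM ?mulgKV // sHG.
(* Move h past t: k = t h t^-1 lies in H, and comparing ga(k t) with ga(t h) gives ga(k) = ga(h) +
   be(h). *)
have twP : {in H, forall h : gal_of E, h (t w) = (-1) ^+ (ga h (+) be h) * t w}.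
  move=> h Hh; have Gh := sHG _ Hh.
  have Hk : (t * h * t^-1)%g \in H by apply: tH; rewrite ?alM ?al_t ?alH // groupM.
  rewrite -galM // -{1}(mulgKV t (t * h)%g) galM // wP // rmorphM rmorph_sign /=.
  congr ((-1) ^+ nat_of_bool _ * _).
  have := gaM _ _ (sHG _ Hk) Gt; rewrite mulgKV (gaM _ _ Gt Gh) (alH _ Hk) al_t /= addbF.
  by case: (ga (_ * _ * _)%g) (ga t) (ga h) (be h) => [] [] [] [].
have ttw : t (t w) = (-1) ^+ be t * w.
  rewrite -galM // wP; last by rewrite HP groupM // alM // al_t.
  by rewrite gaM // addbb al_t.
have Etw : t w \in E by apply: memv_gal.
pose z := w * t w.
have Ez : z \in E by apply: rpredM.
have nz_z : z != 0 by rewrite mulf_neq0 // fmorph_eq0.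
have zP : {in G, forall g : gal_of E, g z = (-1) ^+ be g * z}.
  apply: swap => //; first move=> h Hh.
    by rewrite rmorphM /= wP // twP // signr_addb -[X in _ * X]mulrA mulrACA -signr_addb addbb mul1r mulrCA.
  by rewrite rmorphM /= ttw mulrC -mulrA.
have [v [nz_v zsq vP]] := eigenvector_sqr Ez nz_z zP.
pose m := w ^+ 2; pose m' := t w ^+ 2.
have Em : m \in E by apply: rpredX.
have Em' : m' \in E by apply: rpredX.
have mH : {in H, forall h : gal_of E, h m = m}.
  by move=> h Hh; rewrite rmorphXn /= wP // sqr_sign_sqrt.
have m'H : {in H, forall h : gal_of E, h m' = m'}.
  by move=> h Hh; rewrite rmorphXn /= twP // sqr_sign_sqrt.
have tm : t m = m' by rewrite rmorphXn.
have tm' : t m' = m by rewrite rmorphXn /= ttw sqr_sign_sqrt.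
have fix_of (y : L) : y \in E -> {in H, forall h : gal_of E, h y = y} -> t y = y ->
    exists x : F, y = x%:A.
  move=> Ey Hy ty; apply: (fixed_in_base galE Ey) => g Gg.
  case al_g: (al g); last by apply: Hy; rewrite HP Gg al_g.
  by rewrite -{1}(mulgKV t g) galM // Hy ?tH.
(* r and s are the coordinates of m = w^2 in the basis 1, [w0], computed from m and its conjugate
   m'. *)
have [|h Hh||r Dr] := fix_of ((m + m') / 2%:R).
- by apply: rpred_div; [apply: rpredD | apply: rpred_nat].
- by rewrite fmorph_div rmorphD rmorph_nat /= mH // m'H.
- by rewrite fmorph_div rmorphD rmorph_nat /= tm tm' addrC.
have [|h Hh||s Ds] := fix_of ((m - m') / (2%:R * w0)).
- by apply: rpred_div; [apply: rpredB | apply: rpredM => //; apply: rpred_nat].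
- by rewrite fmorph_div rmorphB [_ (2%:R * _)]rmorphM /= rmorph_nat /= mH // m'H // w0P ?sHG // alH // mul1r.
- rewrite fmorph_div rmorphB [_ (2%:R * _)]rmorphM /= rmorph_nat /= tm tm' w0P // al_t mulN1r.
  by rewrite mulrN invrN mulrN -mulNr opprB.
exists u, v, r, s; split=> //.
have inj : injective (in_alg L) by apply: fmorph_inj.
apply: inj; rewrite [LHS]rmorphXn rmorphD rmorphM rmorphXn /= -Dr -Ds -zsq -w0sq.
have nz2 := char2L L char2F; rewrite /z /m /m'.
by field; rewrite nz2 nz_w0.
Qed.

(* If [r = 0], then <u, v> is isotropic, hence represents 1. *)
Lemma sqr_sum_to_one (u v r s : F) : u != 0 -> v != 0 -> s != 0 ->
  u - 1 != 0 -> (r = 0 -> u + 1 != 0) -> r ^+ 2 = u * s ^+ 2 + v ->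
  exists x y : F, [/\ x != 0, y != 0 & u * x ^+ 2 + v * y ^+ 2 = 1].
Proof.
move=> nz_u nz_v nz_s nz_u1 nz_u1' rsq.
have [r0|nz_r] := eqVneq r 0.
  (* Here v = -u s^2, and the witnesses come from (u + 1)^2 - (u - 1)^2 = 4u. *)
  have {}nz_u1' := nz_u1' r0; exists ((u + 1) / (2%:R * u)), ((u - 1) / (2%:R * u * s)).
  split; rewrite ?mulf_neq0 ?invr_eq0 ?mulf_neq0 //.
  have -> : v = - (u * s ^+ 2) by apply/eqP; rewrite -addr_eq0 addrC -rsq r0 expr0n.
  by field; rewrite char2F nz_u nz_s.
exists (s / r), (r^-1); split; rewrite ?mulf_neq0 ?invr_eq0 //.
have -> : v = r ^+ 2 - u * s ^+ 2 by rewrite rsq addrC addKr.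
by field.
Qed.

(** Rescaling u and v by squares keeps their signs. The degenerate cases u = 1, s = 0, and r = 0
    with u = -1 would make u or v a square, against [al t] or [be t']. *)
Lemma dihedral_sum_one (al be ga : gal_of E -> bool) (t t' : gal_of E) :
  {in G &, {morph al : g h / (g * h)%g >-> g (+) h}} ->
  {in G &, {morph be : g h / (g * h)%g >-> g (+) h}} ->
  {in G &, forall g h, ga (g * h)%g = ga g (+) ga h (+) (al g && be h)} ->
  t \in G -> al t -> t' \in G -> be t' ->
  exists p q : F, [/\ p != 0, q != 0, p + q = 1,
    {in G, forall g, negates g p = al g} & {in G, forall g, negates g q = be g}].
Proof.
move=> alM beM gaM Gt al_t Gt' be_t'.
have [u [v [r [s [nz_u nz_v rsq uP vP]]]]] := dihedral_norm alM beM gaM Gt al_t.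
have v_nsq (x : F) : v != x ^+ 2.
  apply: contraTneq be_t' => Dv; rewrite -vP // Dv negates_sqr //.
  by apply: contraNneq nz_v => x0; rewrite Dv x0 expr0n.
have nz_u1 : u - 1 != 0.
  apply: contraTneq al_t => /eqP; rewrite subr_eq0 => /eqP u1.
  by rewrite -uP // u1 negates1.
have nz_s : s != 0.
  by apply: contraNneq (v_nsq r) => s0; rewrite rsq s0 expr0n mulr0 add0r.
have nz_u1' : r = 0 -> u + 1 != 0.
  move=> r0; apply: contraNneq (v_nsq s) => u1; rewrite -subr_eq0.
  by rewrite -(addKr (u * s ^+ 2) v) -rsq r0 expr0n addr0 -opprD -[X in _ + X]mul1r -mulrDl u1 mul0r oppr0.
have [x [y [nz_x nz_y sum1]]] := sqr_sum_to_one nz_u nz_v nz_s nz_u1 nz_u1' rsq.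
exists (u * x ^+ 2), (v * y ^+ 2); split; rewrite ?mulf_neq0 ?expf_neq0 //.
  by move=> g Gg; rewrite negates_mulsqr ?uP.
by move=> g Gg; rewrite negates_mulsqr ?vP.
Qed.

End Dihedral.

(** * Involutions and signs of sums *)

Lemma adjoin_sqrt_dim (F : fieldType) (L : fieldExtType F) (K : {subfield L}) (y : L) :
  y ^+ 2 \in K -> y \notin K -> \dim_K <<K; y>> = 2%N.
Proof.
move=> Ky2 nKy; rewrite -adjoin_degreeE.
have : (size (minPoly K y) <= size ('X^2 - (y ^+ 2)%:P : {poly L})%R)%N.
  apply: dvdp_leq; first by rewrite -size_poly_eq0 size_XnsubC.
  apply: minPoly_dvdp; first by rewrite rpredB ?rpredX ?polyOverX ?polyOverC.
  by rewrite rootE !hornerE subrr.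
rewrite size_minPoly size_XnsubC // ltnS => deg2; apply/eqP.
rewrite eqn_leq deg2 ltn_neqAle eq_sym adjoin_deg_eq1 nKy /=.
by rewrite adjoin_degreeE divn_gt0 ?adim_gt0 // dimvS ?subv_adjoin.
Qed.

Section Involutions.

Variables (F : fieldType) (L : splittingFieldType F) (E2 E3 : {subfield L}).
Variable sq : F -> L.
Hypothesis charF : [pchar F] =i pred0.
Hypothesis char2F : 2%:R != 0 :> F.
Hypothesis sqE : forall x, sq x ^+ 2 = x%:A.
Hypothesis F2E : is_F2 E2.
Hypothesis F3E : is_F3 E2 E3.
Hypothesis sE23 : (E2 <= E3)%VS.
Hypothesis quadE2 : contains_all_quad_gal E2.

Local Notation negates := (negates sq).

Lemma sq_in_F2 (x : F) : x != 0 -> sq x \in E2.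
Proof. by case: F2E => sqE2 _ /sqE2; apply. Qed.

Lemma one_add_sqrt_norm (u v : F) : u + v = 1 -> (1 + sq u) * (1 - sq u) = v%:A.
Proof. by move=> uv1; rewrite -(addKr u v) uv1 scalerDl scaleNr scale1r -sqE; ring. Qed.

(* The conjugates of b = 1 + sqrt u are b and 1 - sqrt u = b (sqrt v / b)^2. *)
Lemma sqrt_one_add_sqrt (u v : F) : u != 0 -> v != 0 -> u + v = 1 ->
  exists2 y : L, y \in E3 & y ^+ 2 = 1 + sq u.
Proof.
move=> nz_u nz_v uv1; pose b := 1 + sq u.
have nb : b * (1 - sq u) = sq v ^+ 2 by rewrite (one_add_sqrt_norm uv1) sqE.
have nz_b : b != 0.
  have : b * (1 - sq u) != 0 by rewrite nb expf_neq0 // (sqrt_neq0 nz_v (sqE v)).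
  by apply: contraNneq => ->; rewrite mul0r.
have E2b : b \in E2 by rewrite rpredD ?rpred1 ?sq_in_F2.
have conj_b (g : 'AEnd(L)) : exists2 c : L, c \in E2 & g b = b * c ^+ 2.
  have [e ge] : exists e : bool, g (sq u) = (-1) ^+ e * sq u.
    by apply: sqr_eq_sign; rewrite -rmorphXn /= !sqE linearZ /= rmorph1.
  rewrite rmorphD rmorph1 /= ge; case: e {ge}.
    exists (sq v / b); first by rewrite rpred_div ?sq_in_F2.
    by rewrite mulN1r exprMn -nb; field.
  by exists 1; rewrite ?rpred1 // mul1r expr1n mulr1.
have [|y y2] := quadE2 E2b nz_b; first by move=> g _; apply: conj_b.
exists y => //; have [E2y|nE2y] := boolP (y \in E2); first exact: (subvP sE23).
have [quadE3 _] := F3E.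
apply: (subvP (quadE3 <<E2; y>>%AS _)); last exact: memv_adjoin.
split; first exact: subv_adjoin.
  by apply: adjoin_sqrt_dim; rewrite ?y2.
apply: (galois_of_stable charF) => g.
rewrite /= aimg_adjoin; apply/(FadjoinP (K := (g @: E2)%AS)); split.
  by apply: subv_trans (F2_stable F2E g) (subv_adjoin _ _).
(* As g(b) = b c^2, g(y) is y c up to sign and stays in [E2](y). *)
have [c E2c gb] := conj_b g.
have [e ->] : exists e : bool, g y = (-1) ^+ e * (y * c).
  by apply: sqr_eq_sign; rewrite -rmorphXn /= y2 gb exprMn y2.
by rewrite rpredMsign memvM ?memv_adjoin // (subvP (subv_adjoin _ _)).
Qed.

(* If y^2 = 1 + sqrt u and g moves sqrt u, then (y * g y)^2 = v, so g fixes
   sqrt v = +- y * g y as g is an involution. *)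
Lemma involution_sum_one (g : gal_of E3) (u v : F) : (g * g = 1)%g ->
  u != 0 -> v != 0 -> u + v = 1 -> negates g u -> ~~ negates g v.
Proof.
move=> gg nz_u nz_v uv1 gu.
have [y E3y y2] := sqrt_one_add_sqrt nz_u nz_v uv1.
have gsu : g (sq u) = - sq u by rewrite gal_sqrt // gu mulN1r.
have yy2 : (y * g y) ^+ 2 = v%:A.
  by rewrite exprMn -rmorphXn /= y2 rmorphD rmorph1 /= gsu (one_add_sqrt_norm uv1).
rewrite (negates_eq char2F sqE nz_v yy2 (b := false)) //.
by rewrite rmorphM /= -galM // gg gal_id mul1r mulrC.
Qed.

(** Divide by z = x + y: the summands x/z and y/z of 1 have equal signs, so neither is negated,
    which forces z to have the sign of x. *)
Lemma involution_negatesD (g : gal_of E3) (x y : F) : (g * g = 1)%g ->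
  x != 0 -> y != 0 -> x + y != 0 -> negates g x = negates g y ->
  negates g (x + y) = negates g x.
Proof.
move=> gg nz_x nz_y nz_z xy; set z := x + y.
have nz_v : z^-1 != 0 by rewrite invr_eq0.
have sum1 : x * z^-1 + y * z^-1 = 1 by rewrite -mulrDl mulfV.
have negV : negates g z^-1 = negates g z.
  have <- := negates_mulsqr char2F sqE g nz_z nz_v.
  by rewrite expr2 mulrA mulfV ?mul1r.
have := involution_sum_one gg (mulf_neq0 nz_x nz_v) (mulf_neq0 nz_y nz_v) sum1.
rewrite !negatesM // negV -xy; case: (negates g x) (negates g z) => [] [] //= H.
- by have := H isT.
- by have := H isT.
Qed.

End Involutions.

(** * Prescribing signs through the presentation *)

(* The Heisenberg group over F_2, that is, the dihedral group of order 8: a map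
   g |-> (a g, b g, c g) is a homomorphism iff a and b are F_2-characters and c
   is a cochain bounding their cup product. *)
Definition heis2 : Type := (bool * bool * bool)%type.
HB.instance Definition _ := Finite.on heis2.

Definition heis2_mul (x y : heis2) : heis2 :=
  let: (a, b, c) := x in let: (a', b', c') := y in
  (a (+) a', b (+) b', c (+) c' (+) (a && b')).
Definition heis2_inv (x : heis2) : heis2 :=
  let: (a, b, c) := x in (a, b, c (+) (a && b)).

Lemma heis2_mulA : associative heis2_mul.
Proof. by case=> [[[] []] []] [[[] []] []] [[[] []] []]. Qed.
Lemma heis2_mul1 : left_id (false, false, false) heis2_mul.
Proof. by case=> [[[] []] []]. Qed.
Lemma heis2_mulV : left_inverse (false, false, false) heis2_inv heis2_mul.
Proof. by case=> [[[] []] []]. Qed.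
HB.instance Definition _ := Finite_isGroup.Build heis2 heis2_mulA heis2_mul1 heis2_mulV.

Lemma heis2_in_C : in_C heis2.
Proof.
move=> x; split; first by case: x => [[[] []] []].
rewrite inE inE /=; apply/centP => y _; rewrite /commute.
by case: x y => [[[] []] []] [[[] []] []].
Qed.

Lemma heis2_prod (h : 'I_5 -> heis2) :
  ((\prod_i h i)%g.1.1 = \big[addb/false]_i (h i).1.1) *
  ((\prod_i h i)%g.1.2 = \big[addb/false]_i (h i).1.2).
Proof.
split.
  by apply: (big_morph (fun x : heis2 => x.1.1)) => // -[[[] []] []] [[[] []] []].
by apply: (big_morph (fun x : heis2 => x.1.2)) => // -[[[] []] []] [[[] []] []].
Qed.

(** The square of (a, b, c) is (0, 0, ab), so the two conditions on u and v say exactly that the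
    images of the generators and their product square to 1. *)
Lemma C_presented5_heis2 (gT : finGroupType) (s : 'I_5 -> gT) (u v : 'I_5 -> bool) :
  C_presented5 s -> (forall i, ~~ (u i && v i)) ->
  ~~ ((\big[addb/false]_i u i) && (\big[addb/false]_i v i)) ->
  exists f : gT -> heis2, {morph f : x y / (x * y)%g} /\
    forall i, f (s i) = (u i, v i, false).
Proof.
case=> _ _ _ univ uv sum_uv; apply: univ; first exact: heis2_in_C.
split=> [i|]; first by have := uv i; case: (u i) (v i) => [] [].
set x := (\prod_i _)%g.
have x1 : x.1.1 = \big[addb/false]_i u i by rewrite /x heis2_prod.
have x2 : x.1.2 = \big[addb/false]_i v i by rewrite /x heis2_prod.
by move: x1 x2 sum_uv => <- <-; case: x => [[[] []] []].
Qed.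

Lemma sqrt_choice (F : fieldType) (L : fieldExtType F) :
  has_all_sqrts L -> exists sq : F -> L, forall x, sq x ^+ 2 = x%:A.
Proof.
move=> sqrtL.
have ex x : exists z : L, z ^+ 2 == x%:A by have [z /eqP] := sqrtL x; exists z.
by exists (fun x => xchoose (ex x)) => x; apply/eqP; apply: (xchooseP (ex x)).
Qed.

(** Transporting the map to [heis2] along f gives two characters of the Galois group and a cochain
    bounding their cup product; i and j witness that the characters are nontrivial. *)
Lemma sum_one_with_signs (F : fieldType) (L : splittingFieldType F) (E : {subfield L})
    (sq : F -> L) (gT : finGroupType) (s : 'I_5 -> gT)
    (f : {morphism [set: gT] >-> gal_of E}) (u v : 'I_5 -> bool) (i j : 'I_5) :
  2%:R != 0 :> F -> (forall x, sq x ^+ 2 = x%:A) ->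
  galois 1%VS E -> C_presented5 s -> isom [set: gT] 'Gal(E / 1%VS)%g f ->
  (forall k, ~~ (u k && v k)) ->
  ~~ ((\big[addb/false]_k u k) && (\big[addb/false]_k v k)) -> u i -> v j ->
  exists p q : F, [/\ p != 0, q != 0, p + q = 1,
    forall k, negates sq (f (s k)) p = u k & forall k, negates sq (f (s k)) q = v k].
Proof.
move=> char2F sqE galE pres /isomP[injf imf] uv sum_uv ui vj.
have [phi [phiM phi_s]] := C_presented5_heis2 pres uv sum_uv.
pose psi g := phi (invm injf g).
have psiM : {in 'Gal(E / 1%VS)%g &, {morph psi : g h / (g * h)%g}}.
  by move=> g h Gg Gh; rewrite /psi morphM /= ?imf.
have psi_s k : psi (f (s k)) = (u k, v k, false) by rewrite /psi invmE ?inE.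
have Gs k : f (s k) \in 'Gal(E / 1%VS)%g by rewrite -imf mem_morphim ?inE.
have mulE (x y : heis2) : (x * y)%g =
    (x.1.1 (+) y.1.1, x.1.2 (+) y.1.2, x.2 (+) y.2 (+) (x.1.1 && y.1.2)).
  by case: x y => [[? ?] ?] [[? ?] ?].
have [|||||||p [q [nz_p nz_q pq pP qP]]] := @dihedral_sum_one F L E sq char2F sqE galE
   (fun g => (psi g).1.1) (fun g => (psi g).1.2) (fun g => (psi g).2) (f (s i)) (f (s j)).
- by move=> g h Gg Gh; rewrite psiM // mulE.
- by move=> g h Gg Gh; rewrite psiM // mulE.
- by move=> g h Gg Gh; rewrite psiM // mulE.
- exact: Gs.
- by rewrite psi_s.
- exact: Gs.
- by rewrite psi_s.
by exists p, q; split=> // k; rewrite ?pP ?qP // psi_s.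
Qed.

(** * The contradiction for five involutions *)

Theorem theorem3p3 (F : fieldType) (L : splittingFieldType F)
    (E2 E3 : {subfield L}) (gT : finGroupType) (s : 'I_5 -> gT)
    (f : {morphism [set: gT] >-> gal_of E3}) :
  [pchar F] =i pred0 ->
  formally_real F -> pythagorean F ->
  has_all_sqrts L -> is_F2 E2 -> is_F3 E2 E3 -> contains_all_quad_gal E2 ->
  C_presented5 s ->
  isom [set: gT] 'Gal(E3 / 1%VS)%g f ->
  indep_mod_Phi 'Gal(E3 / 1%VS)%G (fun i => f (s i)) ->
  False.
Proof.
move=> charF _ _ sqrtL F2E F3E quadE2 pres isof indep.
have [sq sqE] := sqrt_choice sqrtL.
have char2F : 2%:R != 0 :> F by rewrite ((pcharf0P F).1 charF).
have galE := galois_of_stable charF (F3_stable F3E).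
have sE23 : (E2 <= E3)%VS.
  (* If [E3] were F, [f (s ord0)] would be trivial and so lie in the Frattini subgroup, against
     independence. *)
  apply: F2_sub_F3 F3E _; apply/eqP => E31.
  have /negP[] : f (s ord0) \notin 'Phi('Gal(E3 / 1%VS))%g.
    by have := indep [set ord0]; rewrite big_set1; apply; apply/set0Pn; exists ord0; rewrite inE.
  suff -> : f (s ord0) = 1%g by apply: group1.
  apply/eqP/gal_eqP => z E3z; have /vlineP[k ->] : z \in 1%VS by rewrite -E31.
  by rewrite !gal_alg.
have sq_in x : x != 0 -> sq x \in E3.
  by move=> nz_x; apply: (subvP sE23); apply: sq_in_F2 nz_x.
have [_ _ [s2 sprod2] _] := pres.
have invo k : (f (s k) * f (s k) = 1)%g.
  by rewrite -morphM ?inE // -expg2 s2 morph1.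
pose g := (\prod_i f (s i))%g.
have invo_g : (g * g = 1)%g.
  rewrite /g -(morph_prod f) => [|i _]; last by rewrite inE.
  by rewrite -morphM ?inE // -expg2 sprod2 morph1.
(* The indices 1,...,5 of the header are 0,...,4 here. *)
have [||||p [q [nz_p nz_q pq pP qP]]] := @sum_one_with_signs F L E3 sq gT s f
  (fun k => val k \in [:: 0; 3]%N) (fun k => val k \in [:: 2; 4]%N)
  (inord 0) (inord 2) char2F sqE galE pres isof.
- by case=> [[|[|[|[|[|]]]]]].
- by rewrite !big_ord_recl !big_ord0.
- by rewrite /= inordK.
- by rewrite /= inordK.
have [||||y [b [nz_y nz_b yb yP bP]]] := @sum_one_with_signs F L E3 sq gT s f
  (fun k => val k \in [:: 1; 3]%N) (fun k => val k \in [:: 0; 2]%N)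
  (inord 1) (inord 2) char2F sqE galE pres isof.
- by case=> [[|[|[|[|[|]]]]]].
- by rewrite !big_ord_recl !big_ord0.
- by rewrite /= inordK.
- by rewrite /= inordK.
pose x := y * p + b.
have nz_yp : y * p != 0 by rewrite mulf_neq0.
have nz_yq : y * q != 0 by rewrite mulf_neq0.
have sum1 : y * q + x = 1 by rewrite /x addrA -mulrDr [q + p]addrC pq mulr1.
(* Signs multiply, so the sets of negative indices combine by symmetric difference. *)
have ypP k : negates sq (f (s k)) (y * p) = (val k \in [:: 0; 1]%N).
  by rewrite negatesM // yP pP; case: k => [[|[|[|[|[|]]]]]].
have yqP k : negates sq (f (s k)) (y * q) = (val k \in [:: 1; 2; 3; 4]%N).
  by rewrite negatesM // yP qP; case: k => [[|[|[|[|[|]]]]]].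
have nz_x : x != 0.
  (* If x = 0, then y q = 1, which nothing negates; but y q is negative at index 1. *)
  apply/eqP => x0; have := yqP (inord 1); rewrite /= inordK //.
  by move: sum1; rewrite x0 addr0 => ->; rewrite negates1.
have negD := involution_negatesD charF char2F sqE F2E F3E sE23 quadE2.
have sum_one := involution_sum_one charF char2F sqE F2E F3E sE23 quadE2.
have xP k : negates sq (f (s k)) x = (val k == 0%N).
  (* At indices 1 and 2, y q is negated, so its complement x is not. At 0, 3 and 4, y p and b have
     the same sign, which x = y p + b inherits. *)
  have [yq_k|] := boolP (val k \in [:: 1; 2]%N).
    have yq_neg : negates sq (f (s k)) (y * q).
      by rewrite yqP; case: k yq_k => [[|[|[|]]]].
    rewrite (negPf (sum_one _ _ _ (invo k) nz_yq nz_x sum1 yq_neg)).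
    by case: k yq_k {yq_neg} => [[|[|[|]]]].
  rewrite /x => nyq_k; rewrite negD // ypP ?bP;
    by case: k nyq_k => [[|[|[|[|[|]]]]]].
have gP z : z != 0 -> negates sq g z = \big[addb/false]_k negates sq (f (s k)) z.
  move=> nz_z; apply: (big_morph (fun h => negates sq h z)) => [h h'|].
    by apply: negates_mulg nz_z.
  by rewrite /negates gal_id eqxx.
have : negates sq g x = false.
  (* Both y p and b are negative at two indices, hence positive at the product g, and so is their
     sum x. *)
  have gyp : negates sq g (y * p) = false.
    by rewrite gP // (eq_bigr _ (fun k _ => ypP k)) !big_ord_recl big_ord0.
  have gb : negates sq g b = false.
    by rewrite gP // (eq_bigr _ (fun k _ => bP k)) !big_ord_recl big_ord0.
  by rewrite negD // gyp gb.
(* But x is negative at index 0 only, an odd number of signs. *)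
by rewrite gP // (eq_bigr _ (fun k _ => xP k)) !big_ord_recl big_ord0.
Qed.
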